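(* Let $0<\alpha\leq 1/2$ and let $d_\alpha$ be the metric on $[0,\infty)$ given by $d_\alpha(x,y)=\left((x-y)^2+(x^\alpha-y^\alpha)^2\right)^{1/2}$. Then for all $x,y\geq 0$, $0\leq d_\alpha(x,y)-|x-y|\leq 1$. Consequently, $([0,\infty),d_\alpha)$ is roughly isometric to the Euclidean half-line $[0,\infty)$ (with metric $|x-y|$) and is thus Gromov hyperbolic.
   Context: A metric space $(X,d)$ is Gromov hyperbolic if there exists $\delta\geq 0$ such that for all $x,y,z,w\in X$, $d(x,y)+d(z,w)\leq\max\{d(x,z)+d(y,w),\ d(y,z)+d(x,w)\}+2\delta$. A map $f\colon X\to Y$ between metric spaces $(X,d_X)$ and $(Y,d_Y)$ is a rough isometry if there exists $k\geq 0$ such that $|d_Y(f(u),f(v))-d_X(u,v)|\leq k$ for all $u,v\in X$, and there exists $R>0$ such that for every $y\in Y$ there is $x\in X$ with $d_Y(f(x),y)<R$. Two metric spaces are roughly isometric if there exists a rough isometry between them. *)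

(* Defs.v *)
From HB Require Import structures.
From mathcomp Require Import all_boot all_order all_algebra.
From mathcomp Require Import ring lra.
From mathcomp Require Import all_classical all_reals all_analysis.
Import Order.TTheory GRing.Theory Num.Theory.
Import numFieldNormedType.Exports.

Set Implicit Arguments.
Unset Strict Implicit.
Unset Printing Implicit Defensive.

Local Open Scope ring_scope.

Definition gromov_hyperbolic (R : realType) (X : metricType R) : Prop :=
  exists2 delta : R, 0 <= delta &
    forall x y z w : X,
      mdist x y + mdist z w
        <= Num.max (mdist x z + mdist y w) (mdist y z + mdist x w) + 2 * delta.

Definition rough_isometry (R : realType) (X Y : metricType R) (f : X -> Y)
  : Prop :=
  (exists2 k : R, 0 <= k &
     forall u v : X, `|mdist (f u) (f v) - mdist u v| <= k) /\
  (exists2 r : R, 0 < r & forall y : Y, exists x : X, mdist (f x) y < r).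

Definition roughly_isometric (R : realType) (X Y : metricType R) : Prop :=
  exists f : X -> Y, rough_isometry f.

(* For alpha != 0 the library has 0 `^ alpha = 0, as intended here. *)
Definition d_alpha (R : realType) (alpha x y : R) : R :=
  Num.sqrt ((x - y) ^+ 2 + (x `^ alpha - y `^ alpha) ^+ 2).

Section d_alpha_metric.
Context (R : realType) (alpha : R).

Lemma d_alpha_xx (x : R) : d_alpha alpha x x = 0.
Proof. by rewrite /d_alpha !subrr expr0n addr0 sqrtr0. Qed.

Lemma d_alpha_eq0 (x y : R) : d_alpha alpha x y = 0 -> x = y.
Proof.
move/eqP; rewrite sqrtr_eq0 => h; apply/eqP; rewrite -subr_eq0 -sqrf_eq0.
rewrite eq_le sqr_ge0 andbT (le_trans _ h)// lerDl sqr_ge0 //.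
Qed.

Lemma d_alpha_sym (x y : R) : d_alpha alpha x y = d_alpha alpha y x.
Proof. by rewrite /d_alpha; congr Num.sqrt; ring. Qed.

Lemma sqrt_minkowski (a b c d : R) :
  Num.sqrt ((a + c) ^+ 2 + (b + d) ^+ 2)
    <= Num.sqrt (a ^+ 2 + b ^+ 2) + Num.sqrt (c ^+ 2 + d ^+ 2).
Proof.
have p_ge0 : 0 <= a ^+ 2 + b ^+ 2 by rewrite addr_ge0 ?sqr_ge0.
have q_ge0 : 0 <= c ^+ 2 + d ^+ 2 by rewrite addr_ge0 ?sqr_ge0.
have s_ge0 : 0 <= Num.sqrt (a ^+ 2 + b ^+ 2) + Num.sqrt (c ^+ 2 + d ^+ 2).
  by rewrite addr_ge0 ?sqrtr_ge0.
rewrite -(ger0_norm s_ge0) -sqrtr_sqr ler_wsqrtr//.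
have cs : a * c + b * d <= Num.sqrt ((a ^+ 2 + b ^+ 2) * (c ^+ 2 + d ^+ 2)).
  rewrite (le_trans (ler_norm _))// -sqrtr_sqr ler_wsqrtr// -subr_ge0.
  have -> : (a ^+ 2 + b ^+ 2) * (c ^+ 2 + d ^+ 2) - (a * c + b * d) ^+ 2
            = (a * d - b * c) ^+ 2 by ring.
  exact: sqr_ge0.
by rewrite [leRHS]sqrrD !sqr_sqrtr// -sqrtrM// -mulr_natl; lra.
Qed.

Lemma d_alpha_triangle (y x z : R) :
  d_alpha alpha x z <= d_alpha alpha x y + d_alpha alpha y z.
Proof.
rewrite (le_trans _ (sqrt_minkowski _ _ _ _))//.
by rewrite /d_alpha !addrA !subrK.
Qed.

End d_alpha_metric.

(* Two copies of [0, +oo[, so that each can carry its own metric. *)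
Definition euclidean_halfline (R : realType) : Type := {x : R | 0 <= x}.
Definition d_alpha_halfline (R : realType) (alpha : R) : Type :=
  {x : R | 0 <= x}.

Section euclidean_halfline.
Context (R : realType).
Local Notation H := (euclidean_halfline R).

Definition euclidean_dist (x y : H) : R := `|sval x - sval y|.

Fact euclidean_dist_xx (x : H) : euclidean_dist x x = 0.
Proof. by rewrite /euclidean_dist subrr normr0. Qed.

Fact euclidean_dist_eq0 (x y : H) : euclidean_dist x y = 0 -> x = y.
Proof. by move/normr0_eq0/subr0_eq => h; apply/val_inj. Qed.

Fact euclidean_dist_sym (x y : H) : euclidean_dist x y = euclidean_dist y x.
Proof. exact: distrC. Qed.

Fact euclidean_dist_triangle (y x z : H) :
  euclidean_dist x z <= euclidean_dist x y + euclidean_dist y z.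
Proof. exact: ler_distD. Qed.

HB.instance Definition _ := Choice.copy H {x : R | 0 <= x}.
HB.instance Definition _ := @isMetric.Build R H euclidean_dist
  euclidean_dist_xx euclidean_dist_eq0 euclidean_dist_sym
  euclidean_dist_triangle.

End euclidean_halfline.

Section d_alpha_halfline.
Context (R : realType) (alpha : R).
Local Notation H := (d_alpha_halfline alpha).

Definition d_alpha_dist (x y : H) : R := d_alpha alpha (sval x) (sval y).

Fact d_alpha_dist_xx (x : H) : d_alpha_dist x x = 0.
Proof. exact: d_alpha_xx. Qed.

Fact d_alpha_dist_eq0 (x y : H) : d_alpha_dist x y = 0 -> x = y.
Proof. by move/d_alpha_eq0 => h; apply/val_inj. Qed.

Fact d_alpha_dist_sym (x y : H) : d_alpha_dist x y = d_alpha_dist y x.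
Proof. exact: d_alpha_sym. Qed.

Fact d_alpha_dist_triangle (y x z : H) :
  d_alpha_dist x z <= d_alpha_dist x y + d_alpha_dist y z.
Proof. exact: d_alpha_triangle. Qed.

HB.instance Definition _ := Choice.copy H {x : R | 0 <= x}.
HB.instance Definition _ := @isMetric.Build R H d_alpha_dist
  d_alpha_dist_xx d_alpha_dist_eq0 d_alpha_dist_sym d_alpha_dist_triangle.

End d_alpha_halfline.

(* Main.v *)
Require Import Defs.
From mathcomp Require Import all_boot all_order all_algebra.
From mathcomp Require Import lra.
From mathcomp Require Import all_classical all_reals all_analysis.
Import Order.TTheory GRing.Theory Num.Theory.
Import numFieldNormedType.Exports.

Local Open Scope ring_scope.

(** Put [t = `|x - y|] and [b = x `^ alpha - y `^ alpha], so that
    [d_alpha alpha x y] is the square root of [t ^+ 2 + b ^+ 2].  It is at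
    least [t], and it is at most [t + 1] as soon as [b ^+ 2 <= 1 + 2 * t].
    Since [alpha <= 1], the power function is subadditive, whence
    [`|b| <= t `^ alpha] ([dist_powR]); since moreover [alpha <= 1 / 2],
    [(t `^ alpha) ^+ 2] is at most [t] when [t >= 1] and at most [1] when
    [t <= 1] ([sqr_powR_le]), and so at most [1 + 2 * t].

    Hence the identity map distorts distances by at most [1], and it is onto,
    so it is a rough isometry from the half-line with [d_alpha] to the
    Euclidean one.  The latter is [0]-hyperbolic, being a subset of the line,
    and hyperbolicity pulls back along rough isometries because each side of
    the four-point inequality moves by at most twice the distortion
    ([rough_isometry_hyperbolic]). *)

(** With [s = x + y > 0], the ratios [x / s] and [y / s] lie in [0, 1] and sum
    to [1]; raising them to a power [p <= 1] can only increase them. *)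
Lemma powR_subadditive (R : realType) (p x y : R) :
  0 < p -> p <= 1 -> 0 <= x -> 0 <= y ->
  (x + y) `^ p <= x `^ p + y `^ p.
Proof.
move=> p0 p1 x0 y0.
have [s0|s0] := leP (x + y) 0.
  have -> : x + y = 0 by lra.
  by rewrite powR0 ?gt_eqF// addr_ge0 ?powR_ge0.
have ratio z : 0 <= z -> z <= x + y ->
    z / (x + y) * (x + y) `^ p <= z `^ p.
  move=> z0 zs.
  have -> : z `^ p = (z / (x + y)) `^ p * (x + y) `^ p.
    by rewrite -powRM ?divr_ge0 ?(ltW s0)// divfK ?gt_eqF.
  rewrite ler_wpM2r ?powR_ge0//.
  move: z0; rewrite le_eqVlt => /predU1P[<-|z0].
    by rewrite mul0r powR_ge0.
  by rewrite ger1_powR// divr_gt0//= ler_pdivrMr// mul1r.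
have -> : (x + y) `^ p
    = x / (x + y) * (x + y) `^ p + y / (x + y) * (x + y) `^ p.
  by rewrite -mulrDl -mulrDl divff ?gt_eqF// mul1r.
by apply: lerD; apply: ratio => //; lra.
Qed.

Lemma dist_powR (R : realType) (p x y : R) :
  0 < p -> p <= 1 -> 0 <= x -> 0 <= y ->
  `|x `^ p - y `^ p| <= `|x - y| `^ p.
Proof.
move=> p0 p1.
wlog yx : x y / y <= x.
  move=> H x0 y0; have [yx|/ltW xy] := leP y x; first exact: H.
  by rewrite distrC (distrC x); exact: H.
move=> x0 y0.
have t0 : 0 <= x - y by rewrite subr_ge0.
have mono : y `^ p <= x `^ p by rewrite ge0_ler_powR ?nnegrE// ltW.
rewrite (ger0_norm t0) ger0_norm ?subr_ge0// lerBlDl.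
by have := powR_subadditive _ p y (x - y) p0 p1 y0 t0; rewrite addrC subrK.
Qed.

Lemma sqr_powR_le (R : realType) (p t : R) :
  0 < p -> p <= 1 / 2 -> 0 <= t -> (t `^ p) ^+ 2 <= Num.max 1 t.
Proof.
move=> p0 p2 t0; rewrite -powR_mulrn ?powR_ge0// -powRrM le_max.
have [t1|/ltW t1] := leP t 1.
  (* powers of a number in [0, 1] stay below 1 `^ (p * 2) = 1 *)
  have := @ge0_ler_powR R (p * 2) _ t 1.
  by rewrite powR1 !nnegrE => ->//; lra.
by rewrite (@ler1_powR _ t (p * 2) t1) ?orbT//; lra.
Qed.

Lemma d_alpha_dist_bounds (R : realType) (alpha x y : R) :
  0 < alpha -> alpha <= 1 / 2 -> 0 <= x -> 0 <= y ->
  `|x - y| <= d_alpha alpha x y <= `|x - y| + 1.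
Proof.
move=> a0 a2 x0 y0; rewrite /d_alpha; apply/andP; split.
  by rewrite -sqrtr_sqr ler_wsqrtr// lerDl sqr_ge0.
have t0 := normr_ge0 (x - y).
have b_le : (x `^ alpha - y `^ alpha) ^+ 2 <= Num.max 1 `|x - y|.
  apply: le_trans (sqr_powR_le _ _ _ a0 a2 t0).
  rewrite -real_normK ?num_real// ler_sqr ?nnegrE ?powR_ge0//.
  by apply: dist_powR => //; lra.
have max_le : Num.max 1 `|x - y| <= 1 + 2 * `|x - y|.
  by rewrite ge_max; apply/andP; split; lra.
rewrite -[leRHS]ger0_norm ?addr_ge0// -sqrtr_sqr ler_wsqrtr// [leRHS]sqrrD expr1n.
rewrite real_normK ?num_real// mulr1 -mulr_natl; lra.
Qed.

(** Each side of the four-point inequality is a sum of two distances, so a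
    distortion of [k] costs [2 * k] on each side: [delta] grows to
    [delta + 2 * k]. *)
Lemma rough_isometry_hyperbolic (R : realType) (X Y : metricType R)
    (f : X -> Y) :
  rough_isometry f -> gromov_hyperbolic Y -> gromov_hyperbolic X.
Proof.
move=> [[k k0 fk] _] [delta delta0 hypY].
exists (delta + 2 * k) => [|x y z w]; first lra.
have up u v : mdist u v <= mdist (f u) (f v) + k.
  by have := fk u v; rewrite ler_distl => /andP[]; lra.
have lo u v : mdist (f u) (f v) <= mdist u v + k.
  by have := fk u v; rewrite ler_distl => /andP[]; lra.
have max_le : Num.max (mdist (f x) (f z) + mdist (f y) (f w))
                      (mdist (f y) (f z) + mdist (f x) (f w))
    <= Num.max (mdist x z + mdist y w) (mdist y z + mdist x w) + 2 * k.
  rewrite ge_max -!lerBlDr !le_max; apply/andP; split; apply/orP.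
    by left; have := lo x z; have := lo y w; lra.
  by right; have := lo y z; have := lo x w; lra.
have := hypY (f x) (f y) (f z) (f w); have := up x y; have := up z w; lra.
Qed.

(** Removing the absolute values on the left leaves a signed sum of the four
    points with two plus signs and two minus signs; pairing each plus with the
    minus from the other distance writes it as a sum of two differences that
    occur together on the right. *)
Lemma real_four_point (R : realDomainType) (x y z w : R) :
  `|x - y| + `|z - w|
    <= Num.max (`|x - z| + `|y - w|) (`|y - z| + `|x - w|).
Proof.
have le_n := @ler_norm R; have ge_n (a : R) : - a <= `|a|.
  by rewrite -normrN ler_norm.
have := (le_n (x - z), ge_n (x - z), le_n (y - w), ge_n (y - w)).
have := (le_n (y - z), ge_n (y - z), le_n (x - w), ge_n (x - w)).
move=> [[[? ?] ?] ?] [[[? ?] ?] ?]; rewrite le_max.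
by case: (ger0P (x - y)) => _; case: (ger0P (z - w)) => _;
  apply/orP; (by left; lra) || (by right; lra).
Qed.

Lemma mdist_euclidean (R : realType) (x y : euclidean_halfline R) :
  mdist x y = `|sval x - sval y|.
Proof. by []. Qed.

Lemma mdist_d_alpha (R : realType) (alpha : R) (x y : d_alpha_halfline alpha) :
  mdist x y = d_alpha alpha (sval x) (sval y).
Proof. by []. Qed.

Lemma euclidean_halfline_hyperbolic (R : realType) :
  gromov_hyperbolic (euclidean_halfline R).
Proof.
exists 0 => // x y z w; rewrite mulr0 addr0 !mdist_euclidean.
exact: real_four_point.
Qed.

Lemma d_alpha_halfline_rough_isometry (R : realType) (alpha : R) :
  0 < alpha -> alpha <= 1 / 2 ->
  rough_isometry ((fun x => x) : d_alpha_halfline alpha -> euclidean_halfline R).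
Proof.
move=> a0 a2; split.
  exists 1 => // u v.
  have := d_alpha_dist_bounds _ _ _ _ a0 a2 (svalP u) (svalP v).
  rewrite mdist_d_alpha mdist_euclidean.
  by move=> /andP[? ?]; rewrite ler_distl; apply/andP; split; lra.
by exists 1 => // y; exists y; rewrite mdistxx.
Qed.

Theorem proposition3p1 (R : realType) (alpha : R)
    (alpha_gt0 : 0 < alpha) (alpha_le : alpha <= 1 / 2) :
  (forall x y : R, 0 <= x -> 0 <= y ->
     0 <= d_alpha alpha x y - `|x - y| <= 1) /\
  roughly_isometric (d_alpha_halfline alpha) (euclidean_halfline R) /\
  gromov_hyperbolic (d_alpha_halfline alpha).
Proof.
have rough := d_alpha_halfline_rough_isometry _ _ alpha_gt0 alpha_le.
split => [x y x0 y0|].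
  by rewrite subr_ge0 lerBlDl d_alpha_dist_bounds.
split; first by eexists; exact: rough.
exact: rough_isometry_hyperbolic _ _ _ _ rough (euclidean_halfline_hyperbolic R).
Qed.
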